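(* Let $a>0$ and suppose that $\psi_a(\cdot,y)$ is a convex function on $X$ for every $y\in X$, and that the set $X^*$ of normalized Nash equilibria is non-empty. Assume that one of the following conditions holds: (a) the regularized Nikaido-Isoda function $\psi_a$ is linearly conditioned; (b) the set of normalized Nash equilibria $X^*$ fulfills the weak sharpness property. Let $(r_k)$ be a sequence of real numbers with $r_k>0$ for each $k$ and $\liminf_{k\to\infty} r_k=r>0$. Then for each sequence $(x_k)$ in $X$, with arbitrary starting point $x_0\in X$, satisfying for every $k\ge 0$ $$\psi_a(x_{k+1},z)-\frac1{r_k}\langle z-x_{k+1},\,x_{k+1}-x_k\rangle\le 0\quad\text{for all } z\in X,$$ there exists $k_0\in\mathbb{N}$ such that $x_k\in X^*$ for all $k>k_0$.
   Context: Setting (jointly convex generalized Nash equilibrium problem). There are $N$ players; player $i$ controls $x_i\in\mathbb{R}^{n_i}$, with $\sum_{i=1}^N n_i=n$, and $x=(x_1,\dots,x_N)=(x_{-i},x_i)\in\mathbb{R}^n$, where $x_{-i}\in\mathbb{R}^{n-n_i}$ collects the strategies of all players other than $i$. Given $x_{-i}$, player $i$ minimizes $\theta_i(x_{-i},\cdot)$ over $K_i(x_{-i})=\{x_i\in\mathbb{R}^{n_i} : (x_{-i},x_i)\in X\}$. (Subscripts $k$ on the sequence $(x_k)$ in the claim are iteration indices, with $x_k\in X\subseteq\mathbb{R}^n$.) Standing assumptions: (A1) $X\subseteq\mathbb{R}^n$ is non-empty, closed and convex; (A2) for each $i$, the loss function $\theta_i:\mathbb{R}^{n-n_i}\times\mathbb{R}^{n_i}\to\mathbb{R}$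 is continuously differentiable, and $\theta_i(x_{-i},\cdot)$ is convex for each $x_{-i}\in\mathbb{R}^{n-n_i}$. Define $F:\mathbb{R}^n\to\mathbb{R}^n$ by $F(x)=(\nabla_{x_1}\theta_1(x),\dots,\nabla_{x_N}\theta_N(x))$, where $\nabla_{x_i}$ is the partial gradient with respect to $x_i$. A normalized Nash equilibrium (NNE) is a point $x^*\in X$ with $\langle F(x^* ),y-x^*\rangle\ge 0$ for all $y\in X$; $X^*$ denotes the set of all NNE. For $a>0$, the regularized Nikaido-Isoda function $\psi_a:X\times X\to\mathbb{R}$ is $$\psi_a(x,y)=\sum_{i=1}^N\Big[\theta_i(x_{-i},x_i)-\theta_i(x_{-i},y_i)-\tfrac a2\|x_i-y_i\|^2\Big].$$ For a set $S\subseteq\mathbb{R}^n$, $S^\circ=\{v : \langle v,z\rangle\le 0\ \forall z\in S\}$ is its polar; for a closed convex set $S$ and $x\in S$, the normal cone is $N_S(x)=(S-x)^\circ=\{v:\langle v,z-x\rangle\le 0\ \forall z\in S\}$ and the tangent cone is $T_S(x)=[N_S(x)]^\circ$. $B$ is the (closed) unit ball of $\mathbb{R}^n$, $\|\cdot\|$ is the Euclidean norm, $d(x,S)=\inf_{z\in S}\|x-z\|$, and for $S$ non-empty, closed and convex $P_S(x)$ is the Euclidean projection of $x$ onto $S$. (Under the convexity hypothesis on $\psi_a$, the set $X^*$ is closed and convex.) Weak sharpness property: $X^*$ fulfills the weak sharpness property if there exists $\gamma>0$ such that $$-F(x^* )+\gamma B\ \subseteq\ \bigcap_{x\in X^*}\big[T_X(x)\cap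 N_{X^*}(x)\big]^\circ\quad\text{for all }x^*\in X^* .$$ Linear conditioning: $\psi_a$ is linearly conditioned if there exists $\gamma>0$ such that $\psi_a(x,P_{X^*}(x))\ge\gamma\, d(x,X^* )$ for all $x\in X$. *)

(* Defs.v *)
From HB Require Import structures.
From mathcomp Require Import all_boot all_order all_algebra.
From mathcomp Require Import all_classical all_reals all_analysis.

Set Implicit Arguments.
Unset Strict Implicit.
Unset Printing Implicit Defensive.

Import Order.TTheory GRing.Theory Num.Theory.
Import numFieldNormedType.Exports.

Local Open Scope classical_set_scope.
Local Open Scope ring_scope.

Definition dotv (R : realType) (n : nat) (u v : 'rV[R]_n) : R :=
  \sum_j u 0 j * v 0 j.

(* The library norm `|u| on row vectors is the sup norm; it is used below only
   through the topology, which is the same as the Euclidean one. *)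
Definition enorm (R : realType) (n : nat) (u : 'rV[R]_n) : R :=
  Num.sqrt (dotv u u).

Definition eball (R : realType) (n : nat) : set 'rV[R]_n :=
  [set u | enorm u <= 1].

Definition edist (R : realType) (n : nat) (x : 'rV[R]_n)
    (S : set 'rV[R]_n) : R :=
  inf [set enorm (x - z) | z in S].

(* The point of S nearest to x; it exists and is unique when S is nonempty,
   closed and convex, and the default value x is then not used. *)
Definition proj (R : realType) (n : nat) (S : set 'rV[R]_n)
    (x : 'rV[R]_n) : 'rV[R]_n :=
  xget x [set p | S p /\ forall z, S z -> enorm (x - p) <= enorm (x - z)].

Definition polar (R : realType) (n : nat) (S : set 'rV[R]_n) : set 'rV[R]_n :=
  [set v | forall z, S z -> dotv v z <= 0].

Definition normal_cone (R : realType) (n : nat) (S : set 'rV[R]_n)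
    (x : 'rV[R]_n) : set 'rV[R]_n :=
  polar [set z - x | z in S].

Definition tangent_cone (R : realType) (n : nat) (S : set 'rV[R]_n)
    (x : 'rV[R]_n) : set 'rV[R]_n :=
  polar (normal_cone S x).

Definition gradient (R : realType) (n : nat) (f : 'rV[R]_n -> R)
    (x : 'rV[R]_n) : 'rV[R]_n :=
  \row_j 'D_(delta_mx 0 j) f x.

Definition continuously_differentiable (R : realType) (n : nat)
    (f : 'rV[R]_n -> R) : Prop :=
  (forall x, differentiable f x) /\ continuous (gradient f).

(* A strategy profile x = (x_1, ..., x_N) is a row vector made of N blocks, the
   i-th one, submxrow x i, having width d i. *)
Notation profile R d := 'rV[R]_(\sum_i d i)%N.

(* (x_{-i}, z) *)
Definition replace (R : realType) (N : nat) (d : 'I_N -> nat)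
    (x : profile R d) (i : 'I_N) (z : 'rV[R]_(d i)) : profile R d :=
  \mxrow_j dfwith (submxrow x) i z j.

(* Each loss is a function of the whole profile (x_{-i}, x_i). *)
Definition player_convex (R : realType) (N : nat) (d : 'I_N -> nat)
    (theta : 'I_N -> profile R d -> R) : Prop :=
  forall (i : 'I_N) (x : profile R d),
    @convex_function R 'rV[R]_(d i) setT (fun z => theta i (replace x z)).

Definition partial_gradient (R : realType) (N : nat) (d : 'I_N -> nat)
    (i : 'I_N) (f : profile R d -> R) (x : profile R d) : 'rV[R]_(d i) :=
  gradient (fun z : 'rV[R]_(d i) => f (replace x z)) (submxrow x i).

Definition pseudo_gradient (R : realType) (N : nat) (d : 'I_N -> nat)
    (theta : 'I_N -> profile R d -> R) (x : profile R d) : profile R d :=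
  \mxrow_i partial_gradient i (theta i) x.

Definition NNE (R : realType) (N : nat) (d : 'I_N -> nat)
    (theta : 'I_N -> profile R d -> R) (X : set (profile R d)) :
    set (profile R d) :=
  [set x | X x /\
    forall y, X y -> 0 <= dotv (pseudo_gradient theta x) (y - x)].

Definition nikaido_isoda (R : realType) (N : nat) (d : 'I_N -> nat)
    (theta : 'I_N -> profile R d -> R) (a : R) (x y : profile R d) : R :=
  \sum_i (theta i x - theta i (replace x (submxrow y i))
          - a / 2 * enorm (submxrow x i - submxrow y i) ^+ 2).

Definition weakly_sharp (R : realType) (N : nat) (d : 'I_N -> nat)
    (theta : 'I_N -> profile R d -> R) (X : set (profile R d)) : Prop :=
  exists2 gamma : R, 0 < gamma &
    forall xstar, NNE theta X xstar ->
      [set - pseudo_gradient theta xstar + gamma *: b | b in @eball R _] `<=`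
      \bigcap_(x in NNE theta X)
        polar (tangent_cone X x `&` normal_cone (NNE theta X) x).

Definition linearly_conditioned (R : realType) (N : nat) (d : 'I_N -> nat)
    (theta : 'I_N -> profile R d -> R) (X : set (profile R d)) (a : R) : Prop :=
  exists2 gamma : R, 0 < gamma &
    forall x, X x ->
      gamma * edist x (NNE theta X) <=
      nikaido_isoda theta a x (proj (NNE theta X) x).

(* Main.v *)
Require Import Defs.
From HB Require Import structures.
From mathcomp Require Import all_boot all_order all_algebra.
From mathcomp Require Import all_classical all_reals all_analysis.
From mathcomp Require Import ring lra.

Set Implicit Arguments.
Unset Strict Implicit.
Unset Printing Implicit Defensive.

Import Order.TTheory GRing.Theory Num.Theory.
Import numFieldNormedType.Exports.

Local Open Scope classical_set_scope.
Local Open Scope ring_scope.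

(** Write [psi] for the regularized Nikaido-Isoda function and [F] for the
    pseudo-gradient.  Two first-order inequalities hold for [x], [y] in [X]:
    [[
      <F y, x - y>  <=  psi x y  <=  <F x, x - y> - a/2 |x - y|^2.
    ]]
    The right one ([nikaido_isoda_le]) sums the gradient inequalities of the
    convex functions by which each player sees its own loss.  The left one
    ([nikaido_isoda_ge]) is the gradient inequality of the convex function
    [psi^~ y] at the point [y], where this function vanishes and has gradient
    [F y]: the derivatives in the directions of the opponents cancel, and the
    quadratic term is flat there.  Together they make [F] strongly monotone on
    [X], so that the normalized equilibrium is a single point [p]
    ([NNE_unique]).

    With [X* = {p}], linear conditioning reads [gamma |x - p| <= psi x p].
    Weak sharpness gives the same inequality ([sharp_growth]): the normal cone
    of [{p}] is the whole space, so moving from [- F p] in the direction of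
    [x - p] yields [gamma |x - p| <= <F p, x - p> <= psi x p].

    Testing the proximal step with [z = p] then shows that, as soon as
    [rho <= r_ k], an iterate which is not [p] is closer to [p] than the
    preceding iterate by at least [gamma * rho] ([proximal_step]).  A distance
    can decrease by a fixed amount only finitely often ([finite_descent]), and
    a positive lower limit provides such a [rho] for all large [k]. *)

(** * The Euclidean inner product, and singletons *)

Section Euclidean.
Variables (R : realType) (n : nat).
Implicit Types (u v w : 'rV[R]_n) (S : set 'rV[R]_n).

Lemma dotvC u v : dotv u v = dotv v u.
Proof. by apply: eq_bigr => j _; rewrite mulrC. Qed.

Lemma dotvDl u v w : dotv (u + v) w = dotv u w + dotv v w.
Proof. by rewrite /dotv -big_split; apply: eq_bigr => j _; rewrite mxE mulrDl. Qed.

Lemma dotvZl a u v : dotv (a *: u) v = a * dotv u v.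
Proof. by rewrite /dotv mulr_sumr; apply: eq_bigr => j _; rewrite mxE mulrA. Qed.

Lemma dotvDr u v w : dotv u (v + w) = dotv u v + dotv u w.
Proof. by rewrite !(dotvC u) dotvDl. Qed.

Lemma dotvZr a u v : dotv u (a *: v) = a * dotv u v.
Proof. by rewrite !(dotvC u) dotvZl. Qed.

Lemma dotvNl u v : dotv (- u) v = - dotv u v.
Proof. by rewrite -scaleN1r dotvZl mulN1r. Qed.

Lemma dotvNr u v : dotv u (- v) = - dotv u v.
Proof. by rewrite !(dotvC u) dotvNl. Qed.

Lemma dotv0l u : dotv 0 u = 0.
Proof. by rewrite -(scale0r u) dotvZl mul0r. Qed.

Lemma dotvv_ge0 u : 0 <= dotv u u.
Proof. by apply: sumr_ge0 => j _; rewrite -expr2 sqr_ge0. Qed.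

Lemma enorm_ge0 u : 0 <= enorm u.
Proof. exact: sqrtr_ge0. Qed.

Lemma enorm_sqr u : enorm u ^+ 2 = dotv u u.
Proof. by rewrite sqr_sqrtr // dotvv_ge0. Qed.

Lemma enorm0 : enorm (0 : 'rV[R]_n) = 0.
Proof. by rewrite /enorm dotv0l sqrtr0. Qed.

Lemma enorm0_eq0 u : enorm u = 0 -> u = 0.
Proof.
move=> u0; have /eqP : dotv u u = 0 by rewrite -enorm_sqr u0 expr0n.
rewrite psumr_eq0; last by move=> j _; rewrite -expr2 sqr_ge0.
move=> /allP uj; apply/rowP => j; rewrite mxE.
by have /eqP/eqP := uj j (mem_index_enum j); rewrite mulf_eq0 orbb => /eqP.
Qed.

Lemma enorm_sqrD u v :
  enorm (u + v) ^+ 2 = enorm u ^+ 2 + 2 * dotv u v + enorm v ^+ 2.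
Proof. by rewrite !enorm_sqr !(dotvDl, dotvDr) (dotvC v u); ring. Qed.

Lemma enorm_gt0 u : u != 0 -> 0 < enorm u.
Proof. by rewrite lt0r enorm_ge0 andbT; apply: contra_neq => /enorm0_eq0. Qed.

(** Cauchy-Schwarz, from expanding the squared norm of
    [enorm v *: u - enorm u *: v]. *)
Lemma dotv_le_enorm u v : dotv u v <= enorm u * enorm v.
Proof.
have [->|u0] := eqVneq u 0; first by rewrite dotv0l mulr_ge0 ?enorm_ge0.
have [->|v0] := eqVneq v 0; first by rewrite dotvC dotv0l mulr_ge0 ?enorm_ge0.
have uv0 : 0 < enorm u * enorm v by rewrite mulr_gt0 ?enorm_gt0.
have := dotvv_ge0 (enorm v *: u - enorm u *: v).
rewrite !(dotvDl, dotvDr, dotvNl, dotvNr, dotvZl, dotvZr) -!enorm_sqr (dotvC v u).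
by move=> h; rewrite -(ler_pM2l uv0); lra.
Qed.

Lemma edist_set1 (x p : 'rV[R]_n) : Defs.edist x [set p] = enorm (x - p).
Proof. by rewrite /Defs.edist image_set1 inf1. Qed.

Lemma proj_set1 (x p : 'rV[R]_n) : Defs.proj [set p] x = p.
Proof.
rewrite /Defs.proj; case: xgetP => [y _ [-> _] //|/(_ p) []].
by split=> // z ->.
Qed.

Lemma normal_cone_set1 (p : 'rV[R]_n) : normal_cone [set p] p = setT.
Proof.
apply/seteqP; split=> // v _ _ [z -> <-].
by rewrite subrr dotvC dotv0l.
Qed.

Lemma sub_tangent_cone S x y : S y -> tangent_cone S x (y - x).
Proof. by move=> Sy v /= /(_ (y - x)); rewrite dotvC; apply; exists y. Qed.

End Euclidean.

(** * Directional derivatives and convexity *)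

Section DirectionalDerivatives.
Variables (R : realType).

(** A directional derivative depends only on the values along one line; this
    transports derivatives between the space of one player, the space of
    profiles and the real line, without composing differentials. *)
Lemma is_derive_line (V W U : normedModType R) (f : V -> U) (g : W -> U)
    (x v : V) (p w : W) (l : U) :
  (forall h, f (x + h *: v) = g (p + h *: w)) ->
  is_derive p w g l -> is_derive x v f l.
Proof.
move=> fg [dg dgl].
have fxgp : f x = g p by have := fg 0; rewrite !scale0r !addr0.
have E : (fun h : R => h^-1 *: ((f \o shift x) (h *: v) - f x)) =
         (fun h : R => h^-1 *: ((g \o shift p) (h *: w) - g p)).
  by apply/funext => h; rewrite /= ![_ *: _ + _]addrC fg fxgp.
by split; [rewrite /derivable E | rewrite /derive E].
Qed.

(** By convexity, the difference quotients at [x] in the direction [y - x] are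
    at most [f y - f x] for steps between 0 and 1. *)
Lemma convex_is_derive_le (V : normedModType R) (D : set V) (f : V -> R)
    (x y : V) (l : R) :
  @convex_function R V D f -> D x -> D y ->
  is_derive x (y - x) f l -> l <= f y - f x.
Proof.
move=> fconv Dx Dy [df <-].
rewrite ['D_(y - x) f x]cvg_at_rightE; last exact: df.
apply: limr_le.
  rewrite -(cvg_at_rightE (fun h : R => h^-1 *: ((f \o shift x) _ - f x))) //.
  apply: cvg_trans df; apply: cvg_app.
  move=> A [e egt0 Ae]; exists e => // t te tgt0; apply: Ae => //.
  exact/lt0r_neq0.
near=> h.
have h0 : 0 < h by near: h; exists 1 => /=.
have h1 : h <= 1.
  near: h; exists 1 => //= h; rewrite /= sub0r normrN => /ltW h1 _.
  exact: le_trans (ler_norm _) h1.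
have := fconv (Itv01 (ltW h0) h1) y x (mem_set Dy) (mem_set Dx).
rewrite /conv /= /conv /= /unstable.onem => fh.
have -> : h *: (y - x) + x = h *: y + (1 - h) *: x.
  by rewrite scalerBr scalerBl scale1r addrA addrAC.
rewrite /GRing.scale /= mulrC ler_pdivrMr // lerBlDr (le_trans fh) // /GRing.scale /=.
rewrite le_eqVlt; apply/orP; left; apply/eqP; ring.
Unshelve. all: by end_near. Qed.

End DirectionalDerivatives.

(** * Blocks of a profile *)

Section Profiles.
Variables (R : realType) (N : nat) (d : 'I_N -> nat).
Implicit Types (x y v : profile R d) (i : 'I_N).

Lemma submxrow_replace x i (z : 'rV[R]_(d i)) j :
  submxrow (replace x z) j = dfwith (submxrow x) i z j.
Proof. by rewrite mxrowK. Qed.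

Lemma replace_submxrow x i : replace x (submxrow x i) = x.
Proof.
apply/mxrowP => j; rewrite submxrow_replace.
by case: dfwithP.
Qed.

Lemma submxrowZ (h : R) x i : submxrow (h *: x) i = h *: submxrow x i.
Proof. by apply/rowP => j; rewrite !mxE. Qed.

Lemma replace_line x v i (z w : 'rV[R]_(d i)) (h : R) :
  replace (x + h *: v) (z + h *: w) = replace x z + h *: replace v w.
Proof.
apply/mxrowP => j; rewrite submxrowD submxrowZ !submxrow_replace.
have [<-|ij] := eqVneq i j; first by rewrite !dfwithin.
by rewrite !dfwithout // submxrowD submxrowZ.
Qed.

Lemma replace_decomp v i :
  v = replace v (0 : 'rV[R]_(d i)) + replace 0 (submxrow v i).
Proof.
have := replace_line v 0 0 (submxrow v i) 1.
by rewrite !scale1r addr0 add0r replace_submxrow.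
Qed.

Lemma dotv_profile (u_ : forall i, 'rV[R]_(d i)) v :
  dotv (\mxrow_i u_ i) v = \sum_i dotv (u_ i) (submxrow v i).
Proof.
have dotvE n (u w : 'rV[R]_n) : dotv u w = (u *m w^T) 0 0.
  by rewrite mxE; apply: eq_bigr => j _; rewrite mxE.
rewrite dotvE -[v in LHS]submxrowK tr_mxrow mul_mxrow_mxcol summxE.
by apply: eq_bigr => i _; rewrite dotvE.
Qed.

End Profiles.

(** * First-order bounds on the Nikaido-Isoda function *)

Section Game.
Variables (R : realType) (N : nat) (d : 'I_N -> nat).
Variables (X : set (profile R d)) (theta : 'I_N -> profile R d -> R) (a : R).
Hypothesis theta_C1 : forall i, continuously_differentiable (theta i).
Hypothesis theta_convex : player_convex theta.

Let theta_diff i x : differentiable (theta i) x.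
Proof. by have [] := theta_C1 i. Qed.

Lemma is_derive_replace i (x : profile R d) (z w : 'rV[R]_(d i)) :
  is_derive z w (fun z => theta i (replace x z))
    ('D_(replace 0 w) (theta i) (replace x z)).
Proof.
apply: (@is_derive_line _ _ _ _ _ (theta i) _ _ (replace x z) (replace 0 w)).
  by move=> h; rewrite -replace_line scaler0 addr0.
exact/derivableP/diff_derivable.
Qed.

(** The partial gradient is assembled from derivatives along the coordinates of
    player [i]; differentiability of [theta i] on the whole space makes the
    derivative linear in the direction. *)
Lemma dotv_partial_gradient i (x : profile R d) (w : 'rV[R]_(d i)) :
  dotv (partial_gradient i (theta i) x) w = 'D_(replace 0 w) (theta i) x.
Proof.
have E : w = \sum_j w 0 j *: delta_mx 0 j by exact: row_sum_delta.
have replace_lin : replace (0 : profile R d) w =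
    \sum_j w 0 j *: replace 0 (delta_mx 0 j : 'rV[R]_(d i)).
  apply/mxrowP => j; rewrite submxrow_sum submxrow_replace.
  have [<-|ij] := eqVneq i j.
    rewrite dfwithin [LHS]E; apply: eq_bigr => k _.
    by rewrite submxrowZ submxrow_replace dfwithin.
  rewrite dfwithout // submxrow0 big1 // => k _.
  by rewrite submxrowZ submxrow_replace dfwithout // submxrow0 scaler0.
rewrite deriveE // replace_lin linear_sum.
apply: eq_bigr => j _; rewrite linearZ /= mxE.
have := is_derive_replace x (submxrow x i) (delta_mx 0 j).
by rewrite replace_submxrow => -[_ ->]; rewrite deriveE // mulrC.
Qed.

Lemma dotv_pseudo_gradient (x v : profile R d) :
  dotv (pseudo_gradient theta x) v =
  \sum_i 'D_(replace 0 (submxrow v i)) (theta i) x.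
Proof.
by rewrite dotv_profile; apply: eq_bigr => i _; rewrite dotv_partial_gradient.
Qed.

Lemma nikaido_isoda_diag (x : profile R d) : nikaido_isoda theta a x x = 0.
Proof.
rewrite /nikaido_isoda big1 // => i _.
rewrite replace_submxrow !subrr enorm_sqr.
by rewrite dotv0l mulr0 subrr.
Qed.

(** Concavity side: [theta i (replace x z)] lies above its tangent at
    [z = submxrow x i]. *)
Lemma nikaido_isoda_le (x y : profile R d) :
  nikaido_isoda theta a x y <=
  dotv (pseudo_gradient theta x) (x - y) - a / 2 * enorm (x - y) ^+ 2.
Proof.
have -> : enorm (x - y) ^+ 2 =
    \sum_i enorm (submxrow x i - submxrow y i) ^+ 2.
  rewrite enorm_sqr -{1}(submxrowK (x - y)) dotv_profile.
  by apply: eq_bigr => i _; rewrite enorm_sqr submxrowB.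
rewrite dotv_pseudo_gradient mulr_sumr -sumrB; apply: ler_sum => i _.
rewrite lerD2r.
have dx := is_derive_replace x (submxrow x i) (submxrow y i - submxrow x i).
have := convex_is_derive_le (@theta_convex i x) I I dx.
rewrite replace_submxrow -!dotv_partial_gradient submxrowB.
by rewrite -[submxrow x i - _]opprB dotvNr; lra.
Qed.

(** On the diagonal only the own moves of the players contribute: in the [i]-th
    term the derivative of [theta i] along the moves of the opponents occurs
    twice with opposite signs. *)
Lemma is_derive_nikaido_isoda (y v : profile R d) :
  is_derive y v (fun x => nikaido_isoda theta a x y)
    (dotv (pseudo_gradient theta y) v).
Proof.
pose g i (x : profile R d) := theta i x - theta i (replace x (submxrow y i))
          - a / 2 * enorm (submxrow x i - submxrow y i) ^+ 2.
have -> : (fun x => nikaido_isoda theta a x y) = \sum_i g i.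
  by apply/funext => x; rewrite fct_sumE.
rewrite dotv_pseudo_gradient; apply: is_derive_sum => i.
have d1 : is_derive y v (theta i) ('D_v (theta i) y).
  exact/derivableP/diff_derivable.
have d2 : is_derive y v (fun x => theta i (replace x (submxrow y i)))
    ('D_(replace v (0 : 'rV[R]_(d i))) (theta i) y).
  apply: (@is_derive_line _ _ _ _ _ (theta i) _ _ y (replace v (0 : 'rV_(d i)))).
    move=> h; rewrite -[X in _ = _ (X + _)](replace_submxrow y i).
    by rewrite -replace_line scaler0 addr0.
  exact/derivableP/diff_derivable.
have d3 : is_derive y v
    (fun x => a / 2 * enorm (submxrow x i - submxrow y i) ^+ 2) (0 : R).
  (* Along the line, the quadratic term is [c] times the square of the
     parameter, whose derivative at 0 is 0. *)
  pose c := a / 2 * dotv (submxrow v i) (submxrow v i).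
  apply: (@is_derive_line _ _ _ _ _ (c \*: ((@id R) ^+ 2)) _ _ (0 : R) (1 : R)).
    move=> h; rewrite submxrowD submxrowZ addrC addKr enorm_sqr dotvZl dotvZr.
    by rewrite /= exprfctE add0r /GRing.scale /= /c; ring.
  by apply: is_derive_eq; rewrite expr1 mulr0 scale0r scaler0.
apply: is_derive_eq (is_deriveB (is_deriveB d1 d2) d3) _.
rewrite subr0 !deriveE // -linearB; congr ('d _ _ _).
by rewrite {1}(replace_decomp v i) addrC addKr.
Qed.

(** * Uniqueness of the equilibrium and growth around it *)

Hypothesis X_psi_convex : forall y, X y ->
  @convex_function R (profile R d) X (fun x => nikaido_isoda theta a x y).

(** Convexity side: the tangent of [psi^~ y] at [y], where [psi y y = 0]. *)
Lemma nikaido_isoda_ge (x y : profile R d) : X x -> X y ->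
  dotv (pseudo_gradient theta y) (x - y) <= nikaido_isoda theta a x y.
Proof.
move=> Xx Xy.
have := convex_is_derive_le (X_psi_convex Xy) Xy Xx
  (is_derive_nikaido_isoda y (x - y)).
by rewrite nikaido_isoda_diag subr0.
Qed.

Hypothesis a_gt0 : 0 < a.

(** If [p] and [q] are both equilibria, the two bounds on [psi p q] give
    [0 <= <F q, p - q> <= <F p, p - q> - a/2 |p - q|^2 <= - a/2 |p - q|^2]. *)
Lemma NNE_unique (p : profile R d) :
  NNE theta X p -> NNE theta X = [set p].
Proof.
move=> NNEp; apply/seteqP; split=> [q NNEq|_ ->] //=.
have [[Xp p_le] [Xq q_le]] := (NNEp, NNEq).
have := nikaido_isoda_le p q.
have := nikaido_isoda_ge Xp Xq.
have := q_le _ Xp; have := p_le _ Xq.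
rewrite -[q - p]opprB dotvNr.
move=> h1 h2 h3 h4; apply/esym; apply/subr0_eq/enorm0_eq0/eqP.
rewrite -sqrf_eq0 eq_le sqr_ge0 andbT.
have a2 : 0 < a / 2 by rewrite divr_gt0.
by rewrite -(pmulr_rle0 _ a2); lra.
Qed.

(** Because the set of equilibria is a singleton, weak sharpness is used with
    one point only, and implies linear conditioning. *)
Lemma sharp_growth (p : profile R d) : NNE theta X p ->
  linearly_conditioned theta X a \/ weakly_sharp theta X ->
  exists2 gamma : R, 0 < gamma &
    forall x, X x -> gamma * enorm (x - p) <= nikaido_isoda theta a x p.
Proof.
move=> NNEp; have [Xp _] := NNEp.
rewrite /linearly_conditioned /weakly_sharp (NNE_unique NNEp) => -[] [gamma g0 H].
  by exists gamma => // x /H; rewrite edist_set1 proj_set1.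
exists gamma => // x Xx; apply: le_trans (nikaido_isoda_ge Xx Xp).
have [->|xp] := eqVneq x p.
  by rewrite subrr enorm0 dotvC dotv0l mulr0.
pose e := enorm (x - p).
have e0 : 0 < e by rewrite enorm_gt0 // subr_eq0.
(* The unit vector pointing from [p] to [x] gives the extremal element of
   [- F p + gamma B]. *)
have ball_e : eball (e^-1 *: (x - p)).
  rewrite /eball /= /enorm dotvZl dotvZr -enorm_sqr -/e expr2 mulKf ?gt_eqF //.
  by rewrite mulVf ?gt_eqF // sqrtr1.
have xp_cone : (tangent_cone X p `&` normal_cone [set p] p) (x - p).
  by split; [exact: sub_tangent_cone | rewrite normal_cone_set1].
have := H p erefl _ (ex_intro2 _ _ _ ball_e erefl) p erefl _ xp_cone.
rewrite dotvDl dotvNl !dotvZl -enorm_sqr -/e expr2 mulKf ?gt_eqF //.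
by rewrite addrC subr_le0.
Qed.

End Game.

(** * Finite termination *)

(** With [u = x' - p] and [w = x - x'], the step and the growth condition give
    [gamma * rho * |u| <= <u, w>], hence [gamma * rho <= |w|] by Cauchy-Schwarz,
    and then [(|u| + gamma * rho)^2 <= |u|^2 + 2 <u, w> + |w|^2 = |x - p|^2]. *)
Lemma proximal_step (R : realType) n (p x x' : 'rV[R]_n) (psi gamma rho s : R) :
  0 < gamma -> 0 < rho -> rho <= s -> gamma * enorm (x' - p) <= psi ->
  psi - s^-1 * dotv (p - x') (x' - x) <= 0 ->
  x' = p \/ enorm (x' - p) + gamma * rho <= enorm (x - p).
Proof.
move=> g0 r0 rs psi_ge step.
have [->|x'p] := eqVneq x' p; [by left | right].
have e0 : 0 < enorm (x' - p) by rewrite enorm_gt0 // subr_eq0.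
set u := x' - p in psi_ge e0 *; pose w := x - x'.
have -> : x - p = u + w by rewrite /u /w [RHS]addrC addrA subrK.
have uw : gamma * rho * enorm u <= dotv u w.
  have s0 := lt_le_trans r0 rs.
  have : gamma * enorm u <= s^-1 * dotv u w.
    apply: le_trans psi_ge _; rewrite -subr_le0.
    by move: step; rewrite -(opprB x' p) -(opprB x x') dotvNl dotvNr opprK.
  rewrite ler_pdivlMl // => h; apply: le_trans h.
  by rewrite mulrA ler_pM2r // mulrC ler_pM2r.
(* Otherwise bilinearity would also expand [u] and [w] themselves. *)
clearbody u w.
have w_ge : gamma * rho <= enorm w.
  by rewrite -(ler_pM2r e0) [leRHS]mulrC (le_trans uw) // dotv_le_enorm.
have gr : 0 < gamma * rho by rewrite mulr_gt0.
rewrite -(@ler_pXn2r _ 2) // ?nnegrE ?addr_ge0 ?enorm_ge0 ?(ltW gr) //.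
rewrite sqrrD enorm_sqrD.
have : (gamma * rho) ^+ 2 <= enorm w ^+ 2.
  by rewrite ler_pXn2r // ?nnegrE ?enorm_ge0 // ltW.
by move: uw; rewrite mulr2n; lra.
Qed.

(** The value 0 is absorbing, since a positive decrease from it is impossible;
    away from 0 the decreases add up and are bounded by [D K]. *)
Lemma finite_descent (R : realType) (D : nat -> R) (c : R) (K : nat) :
  0 < c -> (forall k, 0 <= D k) ->
  (forall k, (K <= k)%N -> D k.+1 = 0 \/ D k.+1 + c <= D k) ->
  exists k0, forall k, (k0 < k)%N -> D k = 0.
Proof.
move=> c0 D0 step.
have descent m : D (K + m).+1 = 0 \/ D (K + m).+1 + m.+1%:R * c <= D K.
  elim: m => [|m IH]; first by rewrite addn0 mul1r; exact: step.
  rewrite addnS; have Km : (K <= (K + m).+1)%N by rewrite leqW ?leq_addr.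
  have [D_eq0|Dm] := step _ Km; first by left.
  right; case: IH => [D_eq0|IH].
    by have := D0 (K + m).+2; lra.
  by rewrite -natr1 mulrDl mul1r; lra.
pose M := Num.bound (D K / c).
have M_gt : D K < M%:R * c.
  by rewrite -ltr_pdivrMr // archi_boundP // divr_ge0 // ltW.
exists (K + M)%N => k /subnKC <-; rewrite addSn -addnA.
case: (descent (M + (k - (K + M).+1))%N) => // Dk.
have : M%:R * c <= (M + (k - (K + M).+1)).+1%:R * c.
  by rewrite ler_pM2r // ler_nat leqW // leq_addr.
by have := D0 (K + (M + (k - (K + M).+1))).+1; lra.
Qed.

Lemma limn_einf_gt0 (R : realType) (u : nat -> R) :
  (0 < limn_einf (fun k => (u k)%:E))%E ->
  exists2 rho : R, 0 < rho & exists K, forall k, (K <= k)%N -> rho <= u k.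
Proof.
rewrite limn_einf_lim (cvg_lim _ (@cvg_einfs_sup _ _)) // => /ereal_sup_gt[_ [K _ <-]].
set m := einfs _ K => m_gt0.
have m_le k : (K <= k)%N -> (m <= (u k)%:E)%E.
  by move=> Kk; apply: ereal_inf_lbound; exists k.
move: m_gt0 m_le; case: m => [m m_gt0 m_le|_ /(_ K (leqnn K))|] //.
by exists m => //; exists K => k /m_le.
Qed.

Theorem theorem5p1 (R : realType) (N : nat) (d : 'I_N -> nat)
    (X : set (profile R d)) (theta : 'I_N -> profile R d -> R)
    (X_nonempty : X !=set0)
    (X_closed : closed X)
    (X_convex : @convex_set R (profile R d) X)
    (theta_C1 : forall i, continuously_differentiable (theta i))
    (theta_convex : player_convex theta)
    (a : R) (a_gt0 : 0 < a)
    (psi_convex : forall y, X y ->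
      @convex_function R (profile R d) X
        (fun x => nikaido_isoda theta a x y))
    (NNE_nonempty : NNE theta X !=set0)
    (conditioning : linearly_conditioned theta X a \/ weakly_sharp theta X)
    (r_ : nat -> R) (r : \bar R)
    (r_gt0 : forall k, 0 < r_ k)
    (liminf_r : limn_einf (fun k => (r_ k)%:E) = r)
    (r_pos : (0 < r)%E)
    (x_ : nat -> profile R d)
    (x_in_X : forall k, X (x_ k))
    (x_step : forall k z, X z ->
      nikaido_isoda theta a (x_ k.+1) z
        - (r_ k)^-1 * dotv (z - x_ k.+1) (x_ k.+1 - x_ k) <= 0) :
  exists k0 : nat, forall k : nat, (k0 < k)%N -> NNE theta X (x_ k).
Proof.
have [p NNEp] := NNE_nonempty.
have [gamma gamma_gt0 growth] :=
  sharp_growth theta_C1 theta_convex psi_convex a_gt0 NNEp conditioning.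
have [rho rho_gt0 [K rho_le]] : exists2 rho : R, 0 < rho &
    exists K, forall k, (K <= k)%N -> rho <= r_ k.
  by apply: limn_einf_gt0; rewrite liminf_r.
have [] := @finite_descent R (fun k => enorm (x_ k - p)) (gamma * rho) K.
- exact: mulr_gt0.
- by move=> k; exact: enorm_ge0.
- move=> k /rho_le rho_k; have [Xp _] := NNEp.
  have [->|] := proximal_step gamma_gt0 rho_gt0 rho_k (growth _ (x_in_X k.+1))
    (x_step k p Xp); last by right.
  by left; rewrite subrr enorm0.
- move=> k0 x_p; exists k0 => k /x_p /enorm0_eq0/subr0_eq ->.
  exact: NNEp.
Qed.
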